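(* Let $n\ge 1$ and let $X$ be a finite pure $n$-dimensional simplicial complex such that $X$ and all its links of dimension $>0$ are connected. Assume that $X$ is $(n+1)$-partite and that there is $\lambda >\frac{n-1}{n}$ such that $$\forall \sigma \in X^{(n-2)},\quad \lambda \leq \lambda (X_\sigma).$$ Then for every $-1\le k\le n-2$ and every $k$-dimensional simplex $\tau$ of $X$, if $\mu$ is an eigenvalue of the (weighted) Laplacian of the $1$-skeleton of $X_\tau$ and $0<\mu < \frac{n-k}{n-k-1}$, then $$f^{n-k-2} (\lambda) \leq \mu \leq 1+(n-k)\left(1-f^{n-k-2} (\lambda)\right),$$ where $f(x)=2-\frac{1}{x}$ and $f^l$ denotes $f$ composed with itself $l$ times ($f^0(x)=x$).
   Context: $X$ is pure $n$-dimensional if every simplex of $X$ is a face of an $n$-dimensional simplex. $X^{(j)}$ is the set of $j$-simplices, with $X^{(-1)}=\{\emptyset\}$. For $\tau\in X^{(k)}$, the link $X_\tau$ is the complex of all simplices $\sigma$ of $X$ disjoint from $\tau$ with $\tau\cup\sigma$ a simplex of $X$; it is pure of dimension $n-k-1$, and $X_\emptyset=X$. $X$ is $(n+1)$-partite if there is a disjoint partition $X^{(0)}=S_0\cup\dots\cup S_n$ such that any two vertices joined by an edge lie in different sets $S_i$. Homogeneous weight: for $\tau\in X^{(k)}$, $-1\le k\le n$, $m(\tau)=(n-k)!\,|\{\sigma\in X^{(n)}:\tau\subseteq\sigma\}|$. Weighted Laplacian of the $1$-skeleton of $X_\tau$ ($\tau \in X^{(k)}$, $-1\le k\le n-2$):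 the operator on real functions on the vertices of $X_\tau$ given by $$(\Delta^+_{\tau,0}\phi)(u)=\phi(u)-\sum_{v:\{u,v\}\in X_\tau^{(1)}}\frac{m(\tau\cup\{u,v\})}{m(\tau\cup\{u\})}\phi(v).$$ It is self-adjoint and non-negative for the inner product $\langle\phi,\psi\rangle=\sum_u m(\tau\cup\{u\})\phi(u)\psi(u)$. For $\tau\in X^{(n-2)}$ the link $X_\tau$ is a graph and this operator is the usual (normalized) graph Laplacian up to conjugation. $\lambda(X_\tau)$ denotes its smallest positive eigenvalue. *)

(* Defs.v *)
From HB Require Import structures.
From mathcomp Require Import all_boot all_order all_algebra.
From mathcomp Require Import reals.
From mathcomp Require classical_sets.

Set Implicit Arguments.
Unset Strict Implicit.
Unset Printing Implicit Defensive.

Import Order.TTheory GRing.Theory Num.Theory.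
Local Open Scope ring_scope.

(* A complex is the set of all its simplices, the empty simplex included.
   The elements v of V with [set v] \notin X are not vertices. *)
Definition simplicial_complex (V : finType) (X : {set {set V}}) : Prop :=
  set0 \in X /\ (forall s t : {set V}, s \in X -> t \subset s -> t \in X).

(* Dimensions are integers because the empty simplex has dimension -1. *)
Definition sdim (V : finType) (s : {set V}) : int := #|s|%:Z - 1.

Definition simplices (V : finType) (X : {set {set V}}) (j : int) :
  {set {set V}} := [set s in X | sdim s == j].

Definition vertices (V : finType) (X : {set {set V}}) : {set V} :=
  [set v | [set v] \in X].

(* [set u; v] has cardinal 2, so u <> v. *)
Definition edge (V : finType) (X : {set {set V}}) : rel V :=
  fun u v => [set u; v] \in simplices X 1.

Definition pure (V : finType) (X : {set {set V}}) (n : nat) : Prop :=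
  forall s, s \in X -> exists2 t, t \in simplices X n & s \subset t.

Definition link (V : finType) (X : {set {set V}}) (t : {set V}) :
  {set {set V}} := [set s in X | [disjoint s & t] & t :|: s \in X].

(* Connectedness of a complex is that of its 1-skeleton. *)
Definition connected_complex (V : finType) (X : {set {set V}}) : Prop :=
  {in vertices X &, forall u v, connect (edge X) u v}.

(* In a pure n-dimensional complex the link of a k-simplex has dimension
   n - k - 1. *)
Definition connected_links (V : finType) (X : {set {set V}}) (n : nat) : Prop :=
  forall (k : int) (t : {set V}), t \in simplices X k -> 0 < n%:Z - k - 1 ->
    connected_complex (link X t).

Definition partite (V : finType) (X : {set {set V}}) (n : nat) : Prop :=
  exists S : 'I_n.+1 -> {set V},
    [/\ \bigcup_(i < n.+1) S i = vertices X,
        forall i j, i != j -> [disjoint S i & S j]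
      & forall u v, edge X u v -> forall i, u \in S i -> v \notin S i].

(* The factor is (n - k)! for a simplex of dimension k = #|t| - 1. *)
Definition weight (V : finType) (X : {set {set V}}) (n : nat) (t : {set V}) :
  nat := ((n.+1 - #|t|)`! * #|[set s in simplices X n | t \subset s]|)%N.

Definition link_vertex (V : finType) (X : {set {set V}}) (t : {set V}) :=
  {u : V | u \in vertices (link X t)}.

Definition laplacian (R : realType) (V : finType) (X : {set {set V}}) (n : nat)
    (t : {set V}) (phi : {ffun link_vertex X t -> R^o}) :
    {ffun link_vertex X t -> R^o} :=
  [ffun u => phi u - \sum_(v | edge (link X t) (val u) (val v))
     (weight X n (t :|: [set val u; val v]))%:R
       / (weight X n (t :|: [set val u]))%:R * phi v].

Lemma laplacian_is_linear (R : realType) (V : finType) (X : {set {set V}})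
  (n : nat) (t : {set V}) : linear (@laplacian R V X n t).
Proof.
move=> a f g; apply/ffunP => u; rewrite !ffunE /= /GRing.scale /=.
rewrite mulrBr addrACA -opprD; congr (_ - _).
rewrite mulr_sumr -big_split /=; apply: eq_bigr => v _.
by rewrite !ffunE /GRing.scale /= mulrDr mulrCA.
Qed.

HB.instance Definition _ (R : realType) (V : finType) (X : {set {set V}})
    (n : nat) (t : {set V}) :=
  GRing.isLinear.Build R {ffun link_vertex X t -> R^o}
    {ffun link_vertex X t -> R^o} *:%R (@laplacian R V X n t)
    (@laplacian_is_linear R V X n t).

Definition laplacian_eigenvalue (R : realType) (V : finType)
    (X : {set {set V}}) (n : nat) (t : {set V}) (mu : R) : Prop :=
  passmx.leigenvalue (linfun (@laplacian R V X n t)) mu.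

Definition smallest_positive_eigenvalue (R : realType) (V : finType)
    (X : {set {set V}}) (n : nat) (t : {set V}) (l : R) : Prop :=
  [/\ 0 < l, laplacian_eigenvalue X n t l
    & forall mu : R, 0 < mu -> laplacian_eigenvalue X n t mu -> l <= mu].

(* The default value 0 of xget is only taken when there is no positive
   eigenvalue, hence never for the link of an (n-2)-simplex, which is a graph
   with an edge. *)
Definition spectral_gap (R : realType) (V : finType) (X : {set {set V}})
    (n : nat) (t : {set V}) : R :=
  classical_sets.xget 0 (@smallest_positive_eigenvalue R V X n t).

Definition descent (R : realType) (x : R) : R := 2 - 1 / x.

(* Main.v *)
Require Import Defs.
From mathcomp Require Import all_boot all_order all_algebra.
From mathcomp Require Import reals.
From mathcomp Require classical_sets.
From mathcomp Require Import ring lra zify.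
From mathcomp.real_closed Require Import complex.

(** The weighted Laplacian of the 1-skeleton of the link of [t] is the
    normalized Laplacian of a weighted graph: up to a factorial, the edge
    [{u, v}] weighs the number of facets of [X] that contain [t], [u] and [v].
    The whole proof is about such graphs, given by symmetric non-negative
    weights [b] on all of [V]; writing [D] for the weighted degree, [mu] is an
    eigenvalue when [b phi = (1 - mu) D phi] for some [phi] with [D phi] not
    identically zero.

    The tool is the spectral theorem in the form of a Poincare inequality
    ([poincare]): in a connected graph all of whose positive eigenvalues are at
    least [g], the Dirichlet energy of any function is at least [g] times its
    variance.

    Lower bound ([trickle_down]).  Let [phi] be an eigenfunction of the link of
    [t] for [mu > 0].  Its energy is, up to a constant, the sum of its energies
    in the links of [t + u], over the vertices [u] of the link of [t].  The
    Poincare inequality in each of these bounds the sum from below by [g] times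
    the sum of the local variances; the local mean of [phi] around [u] is
    [(1 - mu) phi u], so these variances add up to
    [(1 - (1 - mu)^2) |phi|^2].  Hence [mu >= g (2 - mu) mu], that is
    [mu >= 2 - 1 / g].  Induction on the dimension, starting from the
    [(n-2)]-simplices, gives [f^(n-k-2)(lambda) <= mu]; the hypothesis
    [lambda > (n-1)/n] keeps all the iterates positive.

    Upper bound ([partite_eigenvalue_le]).  Put [d = n - k - 1], so that the
    link of [t] is [(d+1)]-partite.  From a vertex outside a side, exactly
    [1/d] of the degree goes into this side; so an eigenfunction [phi] whose
    eigenvalue is neither [0] nor [(d+1)/d] has mean zero on each side.  For
    each side [i], let [psi_i] be [phi] multiplied by [-d] on the side [i].
    It has mean zero, and the Poincare inequality applies to it.  As there is
    no edge inside a side, the energy of [psi_i] depends only on the norm of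
    [phi] and on the norm of its restriction to the side; summing over the
    [d + 1] sides gives [mu - 1 <= d (1 - g)].  Since [mu >= g], this forces
    [g <= 1], and then [d] may be replaced by [d + 1]. *)

Set Implicit Arguments.
Unset Strict Implicit.
Unset Printing Implicit Defensive.

Import Order.TTheory GRing.Theory Num.Theory.
Local Open Scope ring_scope.

(** * Symmetric matrices *)

(** Over the complex numbers [A] is unitarily diagonalizable with real
    eigenvalues, and the Rayleigh quotient of [x] is a convex combination of
    them, so one of them is below [g].  Being real, it is an eigenvalue of [A]
    over [R] as well. *)
Lemma rayleigh_lt_eigenvalue (R : rcfType) (N : nat) (A : 'M[R]_N)
    (x : 'rV_N) (g : R) :
  A^T = A -> (x *m A *m x^T) 0 0 < g * (x *m x^T) 0 0 ->
  exists2 a, a < g & eigenvalue A a.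
Proof.
move=> Asym ltxg.
pose toC := real_complex R; pose B := map_mx toC A.
have toC_real (r : R) : (toC r)^* = toC r by rewrite /toC /Num.conj /= oppr0.
have Bherm : B \is sesquilinear.hermsymmx.
  apply/sesquilinear.is_hermitianmxP; rewrite expr0 scale1r.
  by apply/matrixP => i j; rewrite !mxE -{1}Asym mxE toC_real.
set P := spectral.spectralmx B; set D := spectral.spectral_diag B.
have Pu : P \is spectral.unitarymx by exact: spectral.spectral_unitarymx.
have BE : B = invmx P *m diag_mx D *m P.
  by apply/spectral.orthomx_spectralP/spectral.hermitian_normalmx.
have Dreal i : D 0 i \is Num.real.
  by have /mxOverP := spectral.hermitian_spectral_diag_real Bherm.
(* [z] lists the coordinates of [x] in the orthonormal eigenbasis. *)
pose z := map_mx toC x *m invmx P.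
have PV : invmx P = (map_mx Num.conj P^T) by rewrite spectral.invmx_unitary.
have zE : map_mx Num.conj z^T = P *m (map_mx toC x)^T.
  rewrite /z PV trmx_mul map_mxM; congr (_ *m _).
    by rewrite map_trmx trmxK -map_mx_comp map_mx_id // => c /=; rewrite conjCK.
  by apply/matrixP => i j; rewrite !mxE; exact: toC_real.
have normE : toC ((x *m x^T) 0 0) = \sum_i `|z 0 i| ^+ 2.
  have -> : toC ((x *m x^T) 0 0) = (z *m map_mx Num.conj z^T) 0 0.
    rewrite zE /z mulmxA mulmxKV ?spectral.spectral_unit //.
    by rewrite map_trmx -map_mxM [RHS]mxE.
  by rewrite mxE; apply: eq_bigr => i _; rewrite !mxE normCK.
have formE : toC ((x *m A *m x^T) 0 0) = \sum_i D 0 i * `|z 0 i| ^+ 2.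
  have -> : toC ((x *m A *m x^T) 0 0)
      = (z *m diag_mx D *m map_mx Num.conj z^T) 0 0.
    have -> : z *m diag_mx D *m map_mx Num.conj z^T
        = map_mx toC x *m B *m (map_mx toC x)^T by rewrite zE BE !mulmxA.
    by rewrite map_trmx -!map_mxM [RHS]mxE.
  rewrite mxE; apply: eq_bigr => i _.
  by rewrite mul_mx_diag !mxE normCK mulrAC mulrC.
have [i ltDg] : exists i, D 0 i < toC g.
  apply/existsP; apply: contraLR ltxg => /existsPn geDg.
  rewrite -leNgt -lecR rmorphM /= [X in _ * X]normE [X in _ <= X]formE.
  rewrite mulr_sumr.
  apply: ler_sum => i _; apply: ler_wpM2r; first exact: exprn_ge0.
  have := geDg i; rewrite -real_leNgt //.
  by apply/CrealP; exact: toC_real.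
have [a Da] : exists a, D 0 i = toC a.
  by exists (complex.Re (D 0 i)); rewrite /toC RRe_real.
exists a; first by move: ltDg; rewrite Da ltcR.
suff: eigenvalue B (D 0 i) by rewrite Da -(eigenvalue_map (real_complex R)).
apply/eigenvalueP; exists (row i P).
  rewrite BE !mulmxA -!row_mul mulmxV ?spectral.spectral_unit // mul1mx.
  by apply/rowP => j; rewrite mul_diag_mx !mxE.
apply/eqP => rP0; have := spectral.spectral_unit B; rewrite -/P => Pun.
have /rowP/(_ i) : row i (P *m invmx P) = 0 by rewrite row_mul rP0 mul0mx.
by rewrite mulmxV // !mxE eqxx => /eqP; rewrite oner_eq0.
Qed.

Lemma rayleigh_eigenvector (R : rcfType) (V : finType) (M : V -> V -> R)
    (x : V -> R) (g : R) :
  (forall u v, M u v = M v u) ->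
  \sum_u \sum_v M u v * x u * x v < g * \sum_u x u ^+ 2 ->
  exists2 a, a < g & exists2 y : V -> R,
    forall u, \sum_v M u v * y v = a * y u & exists u, y u != 0.
Proof.
move=> Msym ltxg.
have sumE (F : V -> R) : \sum_u F u = \sum_(i < #|V|) F (enum_val i).
  by rewrite -(big_enum_val F); apply: eq_bigl.
pose A : 'M[R]_#|V| := \matrix_(i, j) M (enum_val i) (enum_val j).
pose X : 'rV[R]_#|V| := \row_i x (enum_val i).
have Asym : A^T = A by apply/matrixP => i j; rewrite !mxE.
have normE : (X *m X^T) 0 0 = \sum_u x u ^+ 2.
  by rewrite mxE sumE; apply: eq_bigr => i _; rewrite !mxE expr2.
have formE : (X *m A *m X^T) 0 0 = \sum_u \sum_v M u v * x u * x v.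
  rewrite exchange_big mxE sumE; apply: eq_bigr => j _.
  rewrite !mxE sumE mulr_suml; apply: eq_bigr => i _.
  by rewrite !mxE [M _ _ * _]mulrC.
have [|a lt_ag /eigenvalueP[y yA yN0]] :=
  @rayleigh_lt_eigenvalue R _ A X g Asym.
  by rewrite normE formE.
exists a => //; exists (fun u => y 0 (enum_rank u)) => [u|].
  have /rowP/(_ (enum_rank u)) := yA; rewrite !mxE => <-.
  rewrite sumE; apply: eq_bigr => i _.
  by rewrite enum_valK !mxE enum_rankK mulrC Msym.
have /rV0Pn[i yi] := yN0.
by exists (enum_val i); rewrite enum_valK.
Qed.

(** * Weighted graphs *)

Section WeightedGraph.
Variables (R : rcfType) (V : finType) (b : V -> V -> R).

Definition degree (u : V) : R := \sum_v b u v.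

(** The Dirichlet form of the normalized Laplacian, for the inner product
    weighted by the degrees. *)
Definition energy (phi : V -> R) : R :=
  \sum_u degree u * phi u ^+ 2 - \sum_u \sum_v b u v * phi u * phi v.

(** The equation is multiplied by the degree, so that it is void at the
    points of [V] that are not vertices of the graph; hence the form of the
    second clause. *)
Definition eigenfunction (mu : R) (phi : V -> R) : Prop :=
  (forall u, \sum_v b u v * phi v = (1 - mu) * (degree u * phi u))
  /\ exists u, degree u * phi u != 0.

Definition connected_graph : Prop :=
  forall u v, degree u != 0 -> degree v != 0 ->
    connect (fun x y => b x y != 0) u v.

Hypothesis b_sym : forall u v, b u v = b v u.
Hypothesis b_ge0 : forall u v, 0 <= b u v.

Lemma degree_ge0 u : 0 <= degree u.
Proof. exact: sumr_ge0. Qed.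

Lemma weight_eq0 u v : degree u = 0 -> b u v = 0.
Proof.
move/eqP; rewrite psumr_eq0 // => /allP/(_ v (mem_index_enum _)) /=.
by move/eqP.
Qed.

(** The sum-of-squares form: it shows that the energy is non-negative and
    vanishes only on functions that are constant along the edges. *)
Lemma energyE phi :
  energy phi = 2^-1 * \sum_u \sum_v b u v * (phi u - phi v) ^+ 2.
Proof.
pose Q := \sum_u degree u * phi u ^+ 2.
have Ql : \sum_u \sum_v b u v * phi u ^+ 2 = Q.
  by apply: eq_bigr => u _; rewrite mulr_suml.
have Qr : \sum_u \sum_v b u v * phi v ^+ 2 = Q.
  rewrite exchange_big -Ql; apply: eq_bigr => u _; apply: eq_bigr => v _.
  by rewrite b_sym.
have -> : \sum_u \sum_v b u v * (phi u - phi v) ^+ 2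
    = Q + Q - 2 * \sum_u \sum_v b u v * phi u * phi v.
  rewrite -{1}Ql -Qr -big_split mulr_sumr -sumrB /=; apply: eq_bigr => u _.
  rewrite -big_split mulr_sumr -sumrB /=; apply: eq_bigr => v _; ring.
rewrite /energy -/Q; lra.
Qed.

Lemma energy_ge0 phi : 0 <= energy phi.
Proof.
rewrite energyE mulr_ge0 ?invr_ge0 ?ler0n //.
by apply: sumr_ge0 => u _; apply: sumr_ge0 => v _; rewrite mulr_ge0 ?sqr_ge0.
Qed.

Lemma energy0_edge phi u v : energy phi <= 0 -> b u v != 0 -> phi u = phi v.
Proof.
move=> e_le0 buv; have F_ge0 x y : 0 <= b x y * (phi x - phi y) ^+ 2.
  by rewrite mulr_ge0 ?sqr_ge0.
have /eqP : energy phi = 0 by apply/eqP; rewrite eq_le e_le0 energy_ge0.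
rewrite energyE mulf_eq0 invr_eq0 pnatr_eq0 /=.
rewrite psumr_eq0 => [/allP/(_ u (mem_index_enum _))/=|x _];
  last exact: sumr_ge0.
rewrite psumr_eq0 // => /allP/(_ v (mem_index_enum _)) /=.
by rewrite mulf_eq0 (negPf buv) sqrf_eq0 subr_eq0 => /eqP.
Qed.

Lemma energy_eigenfunction mu phi : eigenfunction mu phi ->
  energy phi = mu * \sum_u degree u * phi u ^+ 2.
Proof.
case=> phiE _; rewrite /energy.
have -> : \sum_u \sum_v b u v * phi u * phi v
    = (1 - mu) * \sum_u degree u * phi u ^+ 2.
  rewrite mulr_sumr; apply: eq_bigr => u _.
  under eq_bigr => v _ do rewrite mulrAC.
  by rewrite -mulr_suml phiE; ring.
ring.
Qed.

Lemma eigenfunction_norm_gt0 mu phi : eigenfunction mu phi ->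
  0 < \sum_u degree u * phi u ^+ 2.
Proof.
have F_ge0 u : 0 <= degree u * phi u ^+ 2.
  by rewrite mulr_ge0 ?degree_ge0 ?sqr_ge0.
case=> _ [u]; rewrite mulf_eq0 negb_or => /andP[du pu].
rewrite lt_neqAle sumr_ge0 // andbT eq_sym psumr_eq0 //; apply/negP.
move=> /allP/(_ u (mem_index_enum _)) /=.
by rewrite mulf_eq0 (negPf du) sqrf_eq0 (negPf pu).
Qed.

(** Self-adjointness tested against the constant function. *)
Lemma sum_graph (phi : V -> R) :
  \sum_u \sum_v b u v * phi v = \sum_u degree u * phi u.
Proof.
rewrite exchange_big; apply: eq_bigr => u _; rewrite mulr_suml.
by apply: eq_bigr => v _; rewrite b_sym.
Qed.

Lemma eigenfunction_mean mu phi : eigenfunction mu phi -> mu != 0 ->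
  \sum_u degree u * phi u = 0.
Proof.
case=> phiE _ mu0; apply: (mulfI mu0); rewrite mulr0.
have := sum_graph phi; under eq_bigr do rewrite phiE.
by rewrite -mulr_sumr; lra.
Qed.

(** Zero is a simple eigenvalue of a connected graph: a function of energy
    at most zero is constant on the vertices, and mean zero makes it vanish. *)
Lemma eigenvalue_gt0 a phi : connected_graph -> eigenfunction a phi ->
  \sum_u degree u * phi u = 0 -> 0 < a.
Proof.
move=> conn phi_eig mean0; rewrite ltNge; apply/negP => a_le0.
have Q_gt0 := eigenfunction_norm_gt0 phi_eig.
have e_le0 : energy phi <= 0.
  by rewrite (energy_eigenfunction phi_eig) mulr_le0_ge0 // ltW.
case: (phi_eig) => _ [u]; rewrite mulf_eq0 negb_or => /andP[du pu].
have phi_const v : degree v != 0 -> phi v = phi u.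
  move=> dv; have /connectP[p] := conn _ _ du dv.
  elim: p u {du pu dv} => [|w p IH] u /=; first by move=> _ ->.
  by case/andP=> buw pth lst; rewrite (IH w) // (energy0_edge e_le0 buw).
move: mean0; under eq_bigr => v _.
  have -> : degree v * phi v = degree v * phi u.
    by have [->|/phi_const ->] := eqVneq (degree v) 0; rewrite ?mul0r.
  over.
rewrite -mulr_suml => /eqP; rewrite mulf_eq0 (negPf pu) orbF.
rewrite psumr_eq0 => [/allP/(_ u (mem_index_enum _))/=|v _];
  last exact: degree_ge0.
by rewrite (negPf du).
Qed.

(** The spectral theorem is applied to the Laplacian conjugated by the square
    roots [s] of the degrees, to which [g] times the projection on the constant
    functions is added.  If the inequality fails for [phi], this matrix has an
    eigenvalue [a < g].  Its eigenvector is orthogonal to the constants, on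
    which the matrix acts as [g], so [a] is an eigenvalue of the Laplacian on
    functions of mean zero, where it is positive by connectedness. *)
Lemma poincare (g : R) : connected_graph ->
  (forall mu phi, 0 < mu -> eigenfunction mu phi -> g <= mu) ->
  forall phi, g * (\sum_u degree u * phi u ^+ 2
                   - (\sum_u degree u * phi u) ^+ 2 / \sum_u degree u)
    <= energy phi.
Proof.
move=> conn gap phi; rewrite leNgt; apply/negP => lt_e.
pose W := \sum_u degree u; pose s u := Num.sqrt (degree u).
have ss u : s u * s u = degree u by rewrite -expr2 sqr_sqrtr ?degree_ge0.
have s0 u : (s u == 0) = (degree u == 0).
  by rewrite sqrtr_eq0 le_eqVlt ltNge degree_ge0 orbF.
have bs u v : b u v / (s u * s v) * (s u * s v) = b u v.
  have [z|nz] := eqVneq (s u * s v) 0; last by rewrite mulfVK.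
  rewrite z mulr0; move/eqP: z; rewrite mulf_eq0 !s0.
  by case/orP=> /eqP/weight_eq0 => [->|bz] //; rewrite b_sym bz.
(* The diagonal entry [g] outside the graph makes any eigenvector for an
   eigenvalue other than [g] vanish there. *)
pose d u : R := if degree u == 0 then g else 1.
pose M u v := d u * (u == v)%:R - b u v / (s u * s v) + g / W * (s u * s v).
have sumM u (y : V -> R) : \sum_v M u v * y v
    = d u * y u - \sum_v b u v / (s u * s v) * y v
      + g / W * s u * \sum_v s v * y v.
  rewrite mulr_sumr; under eq_bigr do rewrite !mulrDl mulNr.
  rewrite big_split sumrB /=; congr (_ - _ + _); last first.
    by apply: eq_bigr => v _; ring.
  rewrite (bigD1 u) //= eqxx mulr1 big1 ?addr0 // => v.
  by rewrite eq_sym => /negPf->; rewrite mulr0 mul0r.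
have [||a lt_ag [y yE [u0 yu0]]] :=
    @rayleigh_eigenvector R V M (fun u => s u * phi u) g.
- move=> u v; rewrite /M [b u v]b_sym [s v * s u]mulrC eq_sym.
  by case: eqP => [->|_]; rewrite ?mulr0.
- have -> : \sum_u (s u * phi u) ^+ 2 = \sum_u degree u * phi u ^+ 2.
    by apply: eq_bigr => u _; rewrite exprMn expr2 ss.
  suff -> : \sum_u \sum_v M u v * (s u * phi u) * (s v * phi v)
      = energy phi + g / W * (\sum_u degree u * phi u) ^+ 2.
    by move: lt_e; rewrite -/W; lra.
  rewrite /energy expr2 mulr_suml mulr_sumr -sumrB -big_split /=.
  apply: eq_bigr => u _; under eq_bigr do rewrite mulrAC.
  rewrite -mulr_suml sumM.
  have -> : \sum_v s v * (s v * phi v) = \sum_v degree v * phi v.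
    by apply: eq_bigr => v _; rewrite mulrA ss.
  rewrite !mulrDl; congr (_ + _); last by rewrite -(ss u); ring.
  congr (_ + _).
    rewrite /d; have [du0|_] := eqVneq (degree u) 0;
      last by rewrite -(ss u); ring.
    have /eqP -> : s u == 0 by rewrite s0 du0.
    by rewrite du0; ring.
  rewrite mulNr; congr (- _); rewrite mulr_suml; apply: eq_bigr => v _.
  by rewrite -{2}(bs u v); ring.
pose psi u := y u / s u; pose T := \sum_u s u * y u.
have y0 u : degree u = 0 -> y u = 0.
  move=> du0; have /eqP su0 : s u == 0 by rewrite s0 du0.
  have := yE u; rewrite sumM su0 mulr0 mul0r addr0 big1 => [|v _]; last first.
    by rewrite weight_eq0 ?mul0r.
  rewrite subr0 /d du0 eqxx => /eqP; rewrite -subr_eq0 -mulrBl mulf_eq0.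
  by rewrite subr_eq0 gt_eqF // => /eqP.
have sy u : s u * y u = degree u * psi u.
  have [du0|du] := eqVneq (degree u) 0; first by rewrite y0 // du0 mulr0 mul0r.
  by rewrite /psi -ss; field; rewrite s0.
have row u : degree u * psi u - \sum_v b u v * psi v + g / W * degree u * T
    = a * (degree u * psi u).
  have := congr1 ( *%R (s u)) (yE u);
    rewrite sumM [s u * (a * _)]mulrCA -sy => <-.
  rewrite !mulrDr; congr (_ + _ + _); last by rewrite -(ss u) -/T; ring.
    rewrite /d; case: eqP => [/y0 ->|_]; by rewrite ?mul1r // !mulr0.
  rewrite mulrN; congr (- _); rewrite mulr_sumr; apply: eq_bigr => v _.
  rewrite -[in LHS](bs u v) /psi.
  have [/y0 ->|dv] := eqVneq (degree v) 0; first by rewrite !(mul0r, mulr0).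
  by move: (b u v / _) => c; field; rewrite s0.
have W_neq0 : W != 0.
  apply: contra_neq yu0 => W0; apply: y0; apply/eqP; move/eqP: W0.
  rewrite psumr_eq0 => [/allP/(_ u0 (mem_index_enum _))//|v _].
  exact: degree_ge0.
have psi_T : \sum_u degree u * psi u = T by apply: eq_bigr => u _; rewrite sy.
(* [T] is the scalar product of [y] with the constant function; summing the
   eigenvalue equation gives [g T = a T]. *)
have T0 : T = 0.
  have : \sum_u (degree u * psi u - \sum_v b u v * psi v + g / W * degree u * T)
      = \sum_u a * (degree u * psi u) by apply: eq_bigr => u _; exact: row.
  rewrite big_split sumrB sum_graph -mulr_suml -mulr_sumr -[RHS]mulr_sumr /=.
  rewrite -/W.
  rewrite divfK // psi_T subrr add0r => /eqP.
  by rewrite -subr_eq0 -mulrBl mulf_eq0 subr_eq0 gt_eqF // => /eqP.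
have psi_eig : eigenfunction a psi.
  split=> [u|]; last first.
    exists u0; rewrite -sy mulf_neq0 // s0; apply: contra_neq yu0; exact: y0.
  have := row u; rewrite T0 mulr0 addr0 => /eqP; rewrite subr_eq => /eqP E.
  by rewrite mulrBl mul1r {1}E addrAC subrr add0r.
have a_gt0 : 0 < a by apply: eigenvalue_gt0 psi_eig _; rewrite ?psi_T.
by have := gap _ _ a_gt0 psi_eig; rewrite leNgt lt_ag.
Qed.
End WeightedGraph.

(** * Localization *)

(** Garland's localization.  Here [b] stands for the graph of a link and [b' u]
    for that of the link of its vertex [u]; the two counting hypotheses say
    that the degree of [v] in the latter is proportional to [b u v], and that
    the local graphs add up to [b]. *)
Lemma trickle_down (R : rcfType) (V : finType) (b : V -> V -> R)
    (b' : V -> V -> V -> R) (e g mu : R) (phi : V -> R) :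
  (forall u v, b u v = b v u) -> (forall u v, 0 <= b u v) -> 0 < e -> 0 < g ->
  (forall u v, degree (b' u) v = e * b u v) ->
  (forall v w, \sum_u b' u v w = e * b v w) ->
  (forall u, g * (\sum_v degree (b' u) v * phi v ^+ 2
      - (\sum_v degree (b' u) v * phi v) ^+ 2 / \sum_v degree (b' u) v)
    <= energy (b' u) phi) ->
  eigenfunction b mu phi -> 0 < mu -> 2 - 1 / g <= mu.
Proof.
move=> b_sym b_ge0 e_gt0 g_gt0 deg_b' sum_b' gap_b' phi_eig mu_gt0.
have Q_gt0 := eigenfunction_norm_gt0 b_ge0 phi_eig.
set Q := \sum_u _ in Q_gt0.
have swapQ : \sum_u \sum_v b u v * phi v ^+ 2 = Q by rewrite sum_graph.
have energy_sum : \sum_u energy (b' u) phi = e * (mu * Q).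
  rewrite -(energy_eigenfunction phi_eig) /energy sumrB mulrBr -/Q -swapQ.
  congr (_ - _).
    rewrite mulr_sumr; apply: eq_bigr => u _; rewrite mulr_sumr.
    by apply: eq_bigr => v _; rewrite deg_b' -mulrA.
  rewrite exchange_big mulr_sumr; apply: eq_bigr => v _ /=.
  rewrite exchange_big mulr_sumr; apply: eq_bigr => w _ /=.
  by rewrite -!mulr_suml sum_b' !mulrA.
(* The local mean of [phi] around [u] is [(1 - mu) * phi u], by the eigenvalue
   equation at [u]. *)
have local_sum u : g * (e * (\sum_v b u v * phi v ^+ 2
      - (1 - mu) ^+ 2 * (degree b u * phi u ^+ 2))) <= energy (b' u) phi.
  apply: le_trans (gap_b' u); rewrite le_eqVlt; apply/orP; left; apply/eqP.
  have sumd (f : V -> R) : \sum_v degree (b' u) v * f v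
      = e * \sum_v b u v * f v.
    by rewrite mulr_sumr; apply: eq_bigr => v _; rewrite deg_b' -mulrA.
  have -> : \sum_v degree (b' u) v = e * degree b u.
    by rewrite [degree b u]/degree mulr_sumr; apply: eq_bigr => v _.
  rewrite !sumd; case: phi_eig => -> _; congr (_ * _); rewrite mulrBr.
  congr (_ - _); have [->|du] := eqVneq (degree b u) 0;
    first by rewrite !(mulr0, mul0r, invr0).
  by field; rewrite du gt_eqF.
have : g * (e * (Q - (1 - mu) ^+ 2 * Q)) <= e * (mu * Q).
  rewrite -energy_sum -[X in X - _]swapQ mulr_sumr -sumrB !mulr_sumr.
  exact: ler_sum.
have -> : g * (e * (Q - (1 - mu) ^+ 2 * Q)) = (g * (2 - mu)) * (e * (mu * Q)).
  by ring.
rewrite -[X in _ <= X]mul1r ler_pM2r ?mulr_gt0 // -ler_pdivlMl // mulr1.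
by rewrite mul1r; lra.
Qed.

(** * Multipartite graphs *)

(** The sides are the fibers of [c] over [I].  The excluded value [d.+1 / d]
    is the eigenvalue of the functions that are constant on each side and have
    mean zero; all other eigenfunctions for nonzero eigenvalues have mean zero
    on each side, which makes the functions [psi] below admissible. *)
Lemma partite_eigenvalue_le (R : rcfType) (V J : finType) (b : V -> V -> R)
    (c : V -> J) (I : {set J}) (d : nat) (g mu : R) (phi : V -> R) :
  (forall u v, b u v = b v u) -> (forall u v, 0 <= b u v) ->
  (0 < d)%N -> #|I| = d.+1 ->
  (forall u v, c u = c v -> b u v = 0) ->
  (forall u, degree b u != 0 -> c u \in I) ->
  (forall u i, i \in I -> c u != i ->
    d%:R * \sum_(v | c v == i) b u v = degree b u) ->
  (forall psi, g * (\sum_u degree b u * psi u ^+ 2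
      - (\sum_u degree b u * psi u) ^+ 2 / \sum_u degree b u)
    <= energy b psi) ->
  eigenfunction b mu phi -> mu != 0 -> mu != d.+1%:R / d%:R ->
  mu - 1 <= d%:R * (1 - g).
Proof.
move=> b_sym b_ge0 d_gt0 cardI same_side supp_I side_deg gap phi_eig mu0
  mu_triv.
have Q_gt0 := eigenfunction_norm_gt0 b_ge0 phi_eig.
set Q := \sum_u _ in Q_gt0; set dR : R := d%:R.
have dR_gt0 : 0 < dR by rewrite ltr0n.
have T0 := eigenfunction_mean b_sym phi_eig mu0.
case: (phi_eig) => phiE _.
have d1 : d.+1%:R = dR + 1 :> R by rewrite -natr1.
have side_mean i : i \in I -> \sum_(u | c u == i) degree b u * phi u = 0.
  move=> iI; set Ti := LHS.
  (* Only vertices outside the side [i] have neighbours in it, and each sends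
     the share [1 / d] of its degree there; the sum of [degree * phi] over them
     is [- Ti], as [phi] has mean zero. *)
  have : dR * ((1 - mu) * Ti) = - Ti.
    rewrite mulr_sumr; under eq_bigr do rewrite -phiE.
    rewrite exchange_big mulr_sumr (bigID (fun v => c v == i)) /=.
    rewrite big1 ?add0r => [|v /eqP cv]; last first.
      rewrite big1 ?mulr0 // => u /eqP cu.
      by rewrite same_side ?mul0r // cu cv.
    have <- : \sum_(u | c u != i) degree b u * phi u = - Ti.
      by apply/eqP; rewrite -addr_eq0 addrC; apply/eqP;
        rewrite -[RHS]T0 [RHS](bigID (fun u => c u == i)).
    apply: eq_bigr => v cv; rewrite -mulr_suml mulrA -(side_deg v i) //.
    by congr (_ * _ * _); apply: eq_bigr => u _; exact: b_sym.
  move=> E; have /eqP : (dR * (1 - mu) + 1) * Ti = 0 by lra.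
  rewrite mulf_eq0 => /orP[/eqP mE|/eqP //]; case/negP: mu_triv; apply/eqP.
  by rewrite -/dR d1; apply: (mulIf (lt0r_neq0 dR_gt0));
    rewrite divfK ?gt_eqF //; lra.
pose k i v : R := (c v == i)%:R.
pose Qi i := \sum_u k i u * (degree b u * phi u ^+ 2).
have kk i u : k i u * k i u = k i u.
  by rewrite /k; case: eqP; rewrite ?mulr1 ?mulr0.
have side_gap i : i \in I -> g * (Q + (dR ^+ 2 - 1) * Qi i)
    <= Q + (dR ^+ 2 - 1) * Qi i - (1 - mu) * (Q - 2 * (dR + 1) * Qi i).
  (* On the side [i] this is [- d * phi], the multiple of [phi] that gives the
     best upper bound after summation over the sides. *)
  move=> iI; pose psi u := phi u - (dR + 1) * (k i u * phi u).
  have normpsi : \sum_u degree b u * psi u ^+ 2 = Q + (dR ^+ 2 - 1) * Qi i.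
    rewrite /Q mulr_sumr -big_split; apply: eq_bigr => u _ /=.
    transitivity (degree b u * phi u ^+ 2
      + ((dR + 1) ^+ 2 * (k i u * k i u) - 2 * (dR + 1) * k i u)
        * (degree b u * phi u ^+ 2)); first by rewrite /psi; ring.
    by rewrite kk; ring.
  have meanpsi : \sum_u degree b u * psi u = 0.
    under eq_bigr do rewrite mulrBr mulrCA.
    rewrite sumrB T0 -mulr_sumr sub0r.
    have -> : \sum_u degree b u * (k i u * phi u) = 0.
      rewrite -[RHS](side_mean i) // [RHS]big_mkcond; apply: eq_bigr => u _ /=.
      by rewrite /k; case: eqP => _; rewrite ?mul1r // mul0r mulr0.
    by rewrite mulr0 oppr0.
  have formk : \sum_u \sum_v k i u * (b u v * phi u * phi v) = (1 - mu) * Qi i.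
    rewrite mulr_sumr; apply: eq_bigr => u _.
    transitivity (k i u * phi u * \sum_v b u v * phi v);
      last by rewrite phiE; ring.
    by rewrite mulr_sumr; apply: eq_bigr => v _; ring.
  have formk' : \sum_u \sum_v k i v * (b u v * phi u * phi v) = (1 - mu) * Qi i.
    rewrite -formk exchange_big; apply: eq_bigr => u _; apply: eq_bigr => v _.
    by rewrite b_sym; ring.
  have formpsi : \sum_u \sum_v b u v * psi u * psi v
      = (1 - mu) * (Q - 2 * (dR + 1) * Qi i).
    have formQ : \sum_u \sum_v b u v * phi u * phi v = (1 - mu) * Q.
      have := energy_eigenfunction phi_eig; rewrite /energy -/Q => E.
      by move: E; set F := \sum_u \sum_v _; lra.
    transitivity ((1 - mu) * Q - (dR + 1) * ((1 - mu) * Qi i)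
                  - (dR + 1) * ((1 - mu) * Qi i)); last by ring.
    rewrite -formQ -{1}formk -formk' !mulr_sumr -!sumrB; apply: eq_bigr => u _.
    rewrite !mulr_sumr -!sumrB; apply: eq_bigr => v _.
    have kkb : k i u * k i v * b u v = 0.
      rewrite /k; case: eqP => [cu|]; last by rewrite !mul0r.
      case: eqP => [cv|]; last by rewrite mulr0 mul0r.
      by rewrite same_side ?mulr0 // cu cv.
    transitivity (b u v * phi u * phi v
      - (dR + 1) * (k i u * (b u v * phi u * phi v))
      - (dR + 1) * (k i v * (b u v * phi u * phi v))
      + (dR + 1) ^+ 2 * (k i u * k i v * b u v) * phi u * phi v).
      by rewrite /psi; ring.
    by rewrite kkb mulr0 !mul0r addr0.
  have := gap psi; rewrite /energy normpsi meanpsi formpsi.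
  by rewrite expr0n mul0r subr0.
have sumQi : \sum_(i in I) Qi i = Q.
  rewrite exchange_big; apply: eq_bigr => u _ /=; rewrite -mulr_suml.
  have [->|du] := eqVneq (degree b u) 0; first by rewrite mul0r mulr0.
  rewrite (bigD1 (c u)) ?supp_I //= /k eqxx big1 ?addr0 ?mul1r // => i.
  by case/andP=> _ /negPf; rewrite eq_sym => ->.
have sum_lin x y : \sum_(i in I) (x * Q + y * Qi i) = x * (dR + 1) * Q + y * Q.
  rewrite big_split -!mulr_sumr sumQi sumr_const cardI -mulr_natr d1 /=; ring.
have ineq : \sum_(i in I) (g * Q + g * (dR ^+ 2 - 1) * Qi i)
    <= \sum_(i in I)
         (mu * Q + (dR ^+ 2 - 1 + (1 - mu) * (2 * (dR + 1))) * Qi i).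
  by apply: ler_sum => i /side_gap; lra.
rewrite !sum_lin in ineq.
have : ((mu - 1) * (dR + 1)) * Q <= (dR * (1 - g) * (dR + 1)) * Q by lra.
by rewrite !ler_pM2r // addr_gt0.
Qed.

(** * The weighted graph of a link *)

Section LinkGraph.
Variables (R : realType) (V : finType) (X : {set {set V}}) (n : nat).

Definition facets (s : {set V}) : {set {set V}} :=
  [set f in simplices X n | s \subset f].

(** Counting facets around a growing simplex is handled by this coface operator
    on functions of sets; iterating it at distinct points outside [t] is
    symmetric in these points, and gives zero in the degenerate cases. *)
Definition insert (F : {set V} -> R) (t : {set V}) (u : V) : R :=
  if u \in t then 0 else F (u |: t).

Lemma insert_sym F t u v :
  insert (fun s => insert F s v) t u = insert (fun s => insert F s u) t v.
Proof.
rewrite /insert !in_setU1 [v == u]eq_sym setUCA.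
by case: (u \in t); case: (v \in t); case: (u == v).
Qed.

Definition vertex_weight (t : {set V}) (u : V) : R :=
  insert (fun s => #|facets s|%:R) t u.

Definition edge_weight (t : {set V}) (u v : V) : R :=
  insert (fun s => vertex_weight s v) t u.

Lemma edge_weight_sym t u v : edge_weight t u v = edge_weight t v u.
Proof. exact: insert_sym. Qed.

Lemma edge_weight_ge0 t u v : 0 <= edge_weight t u v.
Proof. by rewrite /edge_weight /vertex_weight /insert; do !case: ifP. Qed.

Lemma edge_weight_neq0 t u v : edge_weight t u v != 0 ->
  [/\ u \notin t, v \notin t, u != v
    & exists2 f, f \in simplices X n & [set u; v] :|: t \subset f].
Proof.
rewrite /edge_weight /vertex_weight /insert !in_setU1 [v == u]eq_sym.
have [ut|ut] := boolP (u \in t); first by rewrite eqxx.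
have [vt|vt] := boolP (v \in t); first by rewrite orbT eqxx.
have [uv|uv] /= := boolP (u == v); first by rewrite eqxx.
rewrite pnatr_eq0 cards_eq0 => /set0Pn[f]; rewrite inE => /andP[fX sf].
by split=> //; exists f => //; rewrite -setUA setUCA.
Qed.

Lemma card_facet f : f \in simplices X n -> #|f| = n.+1.
Proof. by rewrite inE /sdim => /andP[_ /eqP]; lia. Qed.

(** Double counting of the pairs of a facet through [t] and a vertex of it
    outside [t] that satisfies [P]. *)
Lemma sum_vertex_weight t (P : pred V) :
  \sum_(u | P u) vertex_weight t u
  = \sum_(f in facets t) #|[set u in f :\: t | P u]|%:R.
Proof.
under [RHS]eq_bigr => f _ do rewrite -sum1_card natr_sum big_mkcond /=.
rewrite exchange_big big_mkcond; apply: eq_bigr => u _ /=.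
rewrite /vertex_weight /insert.
have [Pu|nPu] := boolP (P u); last first.
  by rewrite big1 // => f _; rewrite !inE (negPf nPu) andbF.
have [ut|ut] := boolP (u \in t).
  by rewrite big1 // => f _; rewrite !inE ut.
rewrite -sum1_card natr_sum big_mkcond [RHS]big_mkcond;
  apply: eq_bigr => f _ /=.
rewrite !inE ut Pu subUset sub1set andbT /=.
by case: (f \in X); case: (_ == _); case: (u \in f); case: (_ \subset _).
Qed.

Lemma sum_vertex_weightT t :
  \sum_u vertex_weight t u = (n.+1 - #|t|)%:R * #|facets t|%:R.
Proof.
rewrite sum_vertex_weight mulr_natr -sumr_const; apply: eq_bigr => f.
rewrite inE => /andP[fX tf]; congr (_%:R).
transitivity #|f :\: t|; first by apply: eq_card => u; rewrite !inE andbT.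
by rewrite cardsD (setIidPr tf) card_facet.
Qed.

Lemma degree_edge_weight t u :
  degree (edge_weight t) u = (n - #|t|)%:R * vertex_weight t u.
Proof.
rewrite /degree /edge_weight /vertex_weight /insert.
case: ifP => [ut|/negbT ut]; first by rewrite mulr0 big1.
by rewrite -/(vertex_weight _ _) sum_vertex_weightT cardsU1 ut add1n subSS.
Qed.

(** The graph of the link of [u |: t], when [u] is a vertex of the link of [t],
    and the graph without edges otherwise. *)
Definition vertex_link_weight (t : {set V}) (u v w : V) : R :=
  insert (fun s => edge_weight s v w) t u.

Lemma degree_vertex_link t u v :
  degree (vertex_link_weight t u) v = (n - #|t|.+1)%:R * edge_weight t u v.
Proof.
rewrite /vertex_link_weight [edge_weight t u v]/edge_weight /insert /degree.
case: ifP => [_|/negbT ut]; first by rewrite mulr0 big1.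
by rewrite -[LHS]/(degree _ _) degree_edge_weight cardsU1 ut.
Qed.

(** By symmetry [u] may be inserted last; the sum over [u] is then a degree in
    the link of [v |: t]. *)
Lemma sum_vertex_link t v w :
  \sum_u vertex_link_weight t u v w = (n - #|t|.+1)%:R * edge_weight t v w.
Proof.
have rot u : vertex_link_weight t u v w
    = insert (fun s => edge_weight s w u) t v.
  rewrite /vertex_link_weight insert_sym /insert.
  by case: ifP => // _; exact: edge_weight_sym.
under eq_bigr do rewrite rot; rewrite /insert.
rewrite [edge_weight t v w]/edge_weight /insert.
case: ifP => [_|/negbT vt]; first by rewrite mulr0 big1.
by rewrite -[LHS]/(degree _ _) degree_edge_weight cardsU1 vt.
Qed.

Hypothesis complexX : simplicial_complex X.
Hypothesis pureX : pure X n.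

(** By purity every simplex lies in a facet, so the weights detect the
    simplices of [X]. *)
Lemma facets_neq0 s : (#|facets s|%:R != 0 :> R) = (s \in X).
Proof.
rewrite pnatr_eq0 cards_eq0; apply/set0Pn/idP => [[f]|/pureX[f fX sf]].
  by rewrite !inE => /andP[/andP[fX _] sf]; case: complexX => _ /(_ f); apply.
by exists f; rewrite inE fX.
Qed.

Lemma link_vertexE t u : t \in X ->
  (u \in vertices (link X t)) = (vertex_weight t u != 0).
Proof.
move=> tX; rewrite /vertex_weight /insert !inE disjoints1.
have [ut|ut] /= := boolP (u \in t); first by rewrite eqxx andbF.
rewrite facets_neq0 setUC; apply: andb_idl => utX.
by case: complexX => _ /(_ _ [set u] utX); apply; rewrite subsetUl.
Qed.

Lemma edge_weight_edge t u v : edge (link X t) u v ->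
  edge_weight t u v = #|facets (t :|: [set u; v])|%:R
  /\ edge_weight t u v != 0.
Proof.
rewrite /edge !inE => /andP[/andP[_ /andP[dis tuv]] card2].
have uv : u != v.
  by apply: contraL card2 => /eqP ->; rewrite setUid /sdim cards1.
move: dis; rewrite disjoint_subset => /subsetP dis.
have ut : u \notin t by have := dis u; rewrite !inE eqxx; apply.
have vt : v \notin t by have := dis v; rewrite !inE eqxx orbT; apply.
have E : edge_weight t u v = #|facets (t :|: [set u; v])|%:R.
  rewrite /edge_weight /vertex_weight /insert (negPf ut) in_setU1 (negPf vt).
  by rewrite eq_sym (negPf uv) setUCA setUA setUC.
by split=> //; rewrite E facets_neq0.
Qed.

Lemma edge_weight_nonedge t u v : t \in X -> ~~ edge (link X t) u v ->
  edge_weight t u v = 0.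
Proof.
move=> tX; apply: contraNeq => /edge_weight_neq0[ut vt uv [f]].
rewrite inE => /andP[fX _] uvtf; case: complexX => _ /(_ f) sub.
rewrite /edge !inE; apply/andP; split; last first.
  by rewrite /sdim cards2 uv.
rewrite (sub [set u; v]) // ?(subset_trans _ uvtf) ?subsetUl //=.
rewrite (setUC t) sub // andbT disjoint_subset; apply/subsetP => x.
by rewrite !inE => /orP[]/eqP ->.
Qed.

Lemma link_connected t : t \in X -> connected_complex (link X t) ->
  connected_graph (edge_weight t).
Proof.
move=> tX conn u v; rewrite !degree_edge_weight !mulf_eq0 !negb_or.
move=> /andP[_ ul] /andP[_ vl]; rewrite -!link_vertexE // in ul vl.
apply: connect_sub (conn u v ul vl) => x y xy; apply: connect1.
by have [] := edge_weight_edge xy.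
Qed.

Lemma sum_link_vertex t (F : V -> R) :
  (forall v, v \notin vertices (link X t) -> F v = 0) ->
  \sum_v F v = \sum_(w : link_vertex X t) F (val w).
Proof.
move=> F0; rewrite (bigID (mem (vertices (link X t)))) /=.
rewrite [X in _ + X]big1 ?addr0 => [|v /F0 //].
exact: big_sub.
Qed.
End LinkGraph.

(** * Eigenvalues of links *)

Section Spectrum.
Variables (R : realType) (V : finType) (X : {set {set V}}) (n : nat).
Hypothesis complexX : simplicial_complex X.
Hypothesis pureX : pure X n.

Local Notation edge_weight := (@edge_weight R V X n).

(** The factorials of the homogeneous weights turn into the factor
    [n - #|t|], which is the ratio of the degree to the number of facets. *)
Lemma degree_laplacian t (phi : V -> R) (w : link_vertex X t) :
  t \in X -> (#|t| < n)%N ->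
  degree (edge_weight t) (val w)
    * @laplacian R V X n t [ffun v => phi (val v)] w
  = degree (edge_weight t) (val w) * phi (val w)
    - \sum_v edge_weight t (val w) v * phi v.
Proof.
move=> tX tn; rewrite /laplacian !ffunE mulrBr; congr (_ - _).
rewrite (sum_link_vertex (X := X) (t := t)) => [|v]; last first.
  rewrite (link_vertexE R complexX pureX) // negbK => /eqP v0.
  rewrite edge_weight_sym weight_eq0 ?mul0r //; first exact: edge_weight_ge0.
  by rewrite degree_edge_weight v0 mulr0.
rewrite mulr_sumr big_mkcond; apply: eq_bigr => v _ /=.
case: ifPn => uv; last by rewrite edge_weight_nonedge // mul0r.
have [eE nz] := edge_weight_edge R complexX pureX uv.
rewrite eE ffunE mulrA; congr (_ * _).
have := valP w; rewrite (link_vertexE R complexX pureX) // => w_neq0.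
have [wt vt wv _] := edge_weight_neq0 nz.
have wE : vertex_weight R X n t (val w) = #|facets X n (t :|: [set val w])|%:R.
  by rewrite /vertex_weight /insert (negPf wt) setUC.
rewrite degree_edge_weight /weight -!/(facets X n _) !natrM.
rewrite wE in w_neq0 *.
have -> : #|t :|: [set val w]| = #|t|.+1 by rewrite setUC cardsU1 wt.
have -> : #|t :|: [set val w; val v]| = #|t|.+2.
  by rewrite setUC -setUA !cardsU1 in_setU1 (negPf wt) (negPf vt) (negPf wv).
have [m nE] : exists m, (n = m.+1 + #|t|)%N by exists (n - #|t|).-1; lia.
have [-> -> ->] : [/\ n - #|t| = m.+1, n.+1 - #|t|.+1 = m.+1
  & n.+1 - #|t|.+2 = m]%N by split; lia.
rewrite factS natrM; field.
by rewrite w_neq0 nat1r !pnatr_eq0 -lt0n fact_gt0.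
Qed.

Lemma laplacian_eigenvalueP t mu : t \in X -> (#|t| < n)%N ->
  laplacian_eigenvalue X n t mu
  <-> exists phi, eigenfunction (edge_weight t) mu phi.
Proof.
move=> tX tn.
have deg_neq0 (w : link_vertex X t) : degree (edge_weight t) (val w) != 0.
  have := valP w; rewrite (link_vertexE R complexX pureX) // degree_edge_weight.
  by move=> w0; rewrite mulf_neq0 // pnatr_eq0 subn_eq0 -ltnNge.
have kerE (h : {ffun link_vertex X t -> R^o}) :
    (h \in passmx.leigenspace (linfun (@laplacian R V X n t)) mu)
    = (@laplacian R V X n t h == mu *: h).
  by rewrite /passmx.leigenspace memv_ker add_lfunE opp_lfunE scale_lfunE
    id_lfunE lfunE /= subr_eq0.
split=> [eig|[phi [phiE [u]]]].
  pose h := vpick (passmx.leigenspace (linfun (@laplacian R V X n t)) mu).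
  have h0 : h != 0 by rewrite vpick0.
  have /eqP hE : @laplacian R V X n t h == mu *: h by rewrite -kerE memv_pick.
  pose phi v := if insub v is Some w then h w else 0.
  have hphi : h = [ffun w => phi (val w)].
    by apply/ffunP => w; rewrite ffunE /phi valK.
  exists phi; split=> [u|].
    have [ul|ul] := boolP (u \in vertices (link X t)); last first.
      have du : degree (edge_weight t) u = 0.
        move: ul; rewrite (link_vertexE R complexX pureX) // negbK => /eqP v0.
        by rewrite degree_edge_weight v0 mulr0.
      rewrite du mul0r mulr0 big1 // => v _.
      by rewrite weight_eq0 ?mul0r //; exact: edge_weight_ge0.
    have := degree_laplacian phi (Sub u ul : link_vertex X t) tX tn.
    rewrite -hphi hE SubK !ffunE /= {1}hphi ffunE SubK /GRing.scale /=.
    by move: (\sum_v _) => S; lra.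
  have [w hw] : exists w, h w != 0.
    apply/existsP; apply: contraNT h0 => /existsPn h0; apply/eqP/ffunP => w.
    by rewrite ffunE; apply/eqP; have := h0 w; rewrite negbK.
  exists (val w); rewrite mulf_neq0 ?deg_neq0 //.
  by move: hw; rewrite hphi ffunE.
rewrite mulf_eq0 negb_or => /andP[du pu].
have ul : u \in vertices (link X t).
  rewrite (link_vertexE R complexX pureX) //; apply: contra du => /eqP v0.
  by rewrite degree_edge_weight v0 mulr0.
pose h : {ffun link_vertex X t -> R^o} := [ffun w => phi (val w)].
rewrite /laplacian_eigenvalue /passmx.leigenvalue; apply/eqP => ker0.
have : h \in passmx.leigenspace (linfun (@laplacian R V X n t)) mu.
  rewrite kerE; apply/eqP/ffunP => w; apply: (mulfI (deg_neq0 w)).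
  by rewrite (degree_laplacian phi w tX tn) phiE !ffunE /GRing.scale /=; ring.
rewrite ker0 memv0 => /eqP/ffunP/(_ (Sub u ul)).
by rewrite !ffunE SubK => /eqP; rewrite (negPf pu).
Qed.

(** The numbers [(m - 1) / m] form an orbit of the descent map, which is
    increasing on positive reals. *)
Lemma descent_gt (lambda : R) j : (j < n)%N -> (n%:R - 1) / n%:R < lambda ->
  ((n - j)%:R - 1) / (n - j)%:R < iter j (@descent R) lambda.
Proof.
move=> jn lam; elim: j jn => [|j IH] jn; first by rewrite subn0.
have [m nE] : exists m, (n - j = m.+2)%N by exists (n - j).-2; lia.
have := IH (ltnW jn); rewrite subnS nE iterS /= /descent.
move: (iter _ _ _) => x; rewrite -[m.+2%:R]natr1 -[m.+1%:R]natr1.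
set y : R := m%:R.
have y_ge0 : 0 <= y by rewrite ler0n.
rewrite addrK => ltx; have x_gt0 : 0 < x.
  by apply: le_lt_trans ltx; rewrite divr_ge0 //; lra.
move: ltx; rewrite ltr_pdivrMr; last lra.
rewrite addrK => ltx.
rewrite ltr_pdivrMr; last lra.
rewrite -subr_gt0.
have -> : (2 - 1 / x) * (y + 1) - y = (x * (y + 1 + 1) - (y + 1)) / x.
  by field; rewrite gt_eqF.
by rewrite divr_gt0 // subr_gt0.
Qed.

Hypothesis linksX : connected_links X n.

Lemma link_graph_connected t : t \in X -> (#|t| < n)%N ->
  connected_graph (edge_weight t).
Proof.
move=> tX tn; apply: link_connected => //.
by apply: (linksX (k := sdim t)); rewrite ?inE ?tX ?eqxx // /sdim; lia.
Qed.

Variable lambda : R.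
Hypothesis lambda_gt : (n%:R - 1) / n%:R < lambda.
Hypothesis gapX : forall s : {set V}, s \in simplices X (n%:Z - 2) ->
  lambda <= spectral_gap R X n s.

(** Induction on the codimension of [t].  A vertex [u] of the link of [t] gives
    a link of smaller dimension, to which the induction hypothesis and hence
    the Poincare inequality applies. *)
Lemma eigenvalue_ge j t : t \in X -> (#|t| + j.+1 = n)%N ->
  forall mu phi, 0 < mu -> eigenfunction (edge_weight t) mu phi ->
  iter j (@descent R) lambda <= mu.
Proof.
elim: j t => [|j IH] t tX tn mu phi mu_gt0 phi_eig.
  have gap_t : lambda <= spectral_gap R X n t.
    by apply: gapX; rewrite inE tX /sdim; lia.
  have lam_gt0 : 0 < lambda.
    by apply: le_lt_trans lambda_gt; rewrite divr_ge0 // subr_ge0 ler1n; lia.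
  move: gap_t; rewrite /spectral_gap.
  (* The default value is ruled out, as [lambda] is positive. *)
  case: classical_sets.xgetP => [l _ [_ _ l_min] lam_l|_ lam0]; last lra.
  apply: le_trans lam_l (l_min mu mu_gt0 _).
  by apply/laplacian_eigenvalueP; [|lia|exists phi].
have [e_gt0 tnlt] : (0 < n - #|t|.+1 /\ #|t| < n)%N by split; lia.
have g_gt0 : 0 < iter j (@descent R) lambda.
  apply: le_lt_trans (descent_gt _ lambda_gt); last lia.
  by rewrite divr_ge0 // subr_ge0 ler1n; lia.
rewrite iterS /descent.
apply: (@trickle_down R V (edge_weight t) (@vertex_link_weight R V X n t)
          (n - #|t|.+1)%:R _ mu phi) => //.
- by move=> u v; rewrite edge_weight_sym.
- by move=> u v; apply: edge_weight_ge0.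
- by rewrite ltr0n.
- by move=> u v; rewrite degree_vertex_link.
- by move=> v w; rewrite sum_vertex_link.
move=> u.
have [utX|utX] := boolP ((u \notin t) && (u |: t \in X)).
  case/andP: utX => ut utX.
  have -> : vertex_link_weight R X n t u = edge_weight (u |: t).
    by rewrite /vertex_link_weight /insert (negPf ut).
  have utn : (#|u |: t| + j.+1 = n)%N by rewrite cardsU1 ut; lia.
  apply: poincare.
  - by move=> v w; rewrite edge_weight_sym.
  - by move=> v w; apply: edge_weight_ge0.
  - by apply: link_graph_connected => //; lia.
  exact: IH.
have b0 v w : vertex_link_weight R X n t u v w = 0.
  rewrite /vertex_link_weight /insert; case: ifPn => // ut.
  apply/eqP; apply: contraR utX => /edge_weight_neq0[_ _ _ [f fX sf]].
  rewrite ut; case: complexX => _ /(_ f); apply.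
    by move: fX; rewrite inE => /andP[].
  by apply: subset_trans sf; exact: subsetUr.
have d0 v : degree (vertex_link_weight R X n t u) v = 0.
  by apply: big1 => w _; exact: b0.
rewrite /energy !big1 ?mul0r ?subrr ?mulr0 ?expr0n ?mul0r ?subrr ?mulr0 //.
- by move=> v _; rewrite big1 // => w _; rewrite b0 !mul0r.
- by move=> v _; rewrite d0 mul0r.
- by move=> v _; rewrite d0 mul0r.
Qed.
End Spectrum.

(** * Colorings of partite complexes *)

Definition proper_coloring (V : finType) (X : {set {set V}}) (n : nat)
    (c : V -> 'I_n.+1) : Prop :=
  forall s, s \in X -> {in s &, injective c}.

Lemma partite_coloring (V : finType) (X : {set {set V}}) (n : nat) :
  simplicial_complex X -> partite X n -> exists c, @proper_coloring V X n c.
Proof.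
case=> _ sub [S [cover_S _ edge_S]].
exists (fun v => odflt ord0 [pick i | v \in S i]) => s sX u v us vs.
have in_S w : w \in s -> w \in S (odflt ord0 [pick i | w \in S i]).
  move=> ws; case: pickP => //= none.
  have : w \in vertices X by rewrite inE (sub s) // sub1set.
  by rewrite -cover_S => /bigcupP[i _]; rewrite none.
move=> cuv; apply/eqP; apply: contraTT (in_S _ vs) => uv.
rewrite -cuv; apply: edge_S (in_S _ us); rewrite /edge inE (sub s) //=.
  by rewrite /sdim cards2 uv.
by rewrite subUset !sub1set us.
Qed.

Section Coloring.
Variables (R : realType) (V : finType) (X : {set {set V}}) (n : nat).
Hypothesis complexX : simplicial_complex X.
Hypothesis pureX : pure X n.
Variable c : V -> 'I_n.+1.
Hypothesis c_proper : proper_coloring X c.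

Local Notation edge_weight := (@edge_weight R V X n).

Lemma card_free_colors (t : {set V}) : t \in X ->
  #|~: (c @: t)| = (n.+1 - #|t|)%N.
Proof.
by move=> tX; rewrite cardsCs setCK card_ord card_in_imset //;
  exact: (@c_proper _ tX).
Qed.

(** A facet has as many vertices as there are colors, all of distinct colors. *)
Lemma facet_color f i : f \in simplices X n -> exists2 v, v \in f & c v = i.
Proof.
move=> fX; have fS : f \in X by move: fX; rewrite inE => /andP[].
suff /setP/(_ i) : c @: f = setT by rewrite inE => /imsetP[v vf ->]; exists v.
apply/eqP; rewrite eqEcard subsetT cardsT card_ord.
by rewrite card_in_imset ?(card_facet fX) ?leqnn //; exact: (@c_proper _ fS).
Qed.

Lemma edge_weight_same_color t u v : c u = c v -> edge_weight t u v = 0.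
Proof.
move=> cuv; apply/eqP/negPn/negP => /edge_weight_neq0[_ _ uv [f]].
rewrite inE => /andP[fX _] sf; case/eqP: uv.
have c_inj := @c_proper _ fX; apply: c_inj => //; apply: (subsetP sf);
  by rewrite !inE eqxx ?orbT.
Qed.

Lemma degree_free_color (t : {set V}) u : degree (edge_weight t) u != 0 ->
  c u \in ~: (c @: t).
Proof.
rewrite degree_edge_weight mulf_eq0 negb_or /vertex_weight /insert.
case/andP=> _; case: ifPn => [|ut]; first by rewrite eqxx.
rewrite (facets_neq0 R complexX pureX) => utX; rewrite inE.
apply/imsetP => -[v vt cuv].
have c_inj := @c_proper _ utX.
have uv : u = v by apply: c_inj => //; rewrite !inE ?eqxx ?vt ?orbT.
by rewrite uv vt in ut.
Qed.

(** Every facet through [u |: t] has exactly one vertex of color [i], and it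
    lies outside [u |: t]. *)
Lemma degree_color_class (t : {set V}) u i : i \in ~: (c @: t) -> c u != i ->
  (n - #|t|)%:R * \sum_(v | c v == i) edge_weight t u v
  = degree (edge_weight t) u.
Proof.
rewrite inE => it cui; rewrite degree_edge_weight; congr (_ * _).
rewrite /edge_weight /vertex_weight /insert.
case: ifPn => ut; first by rewrite big1.
rewrite -[LHS]/(\sum_(v | c v == i) vertex_weight R X n (u |: t) v).
rewrite sum_vertex_weight -sumr_const; apply: eq_bigr => f.
rewrite inE => /andP[fX sf].
have [v vf cv] := facet_color i fX.
have fS : f \in X by move: fX; rewrite inE => /andP[].
have -> : [set w in f :\: (u |: t) | c w == i] = [set v];
  last by rewrite cards1.
apply/setP => w; rewrite !inE; apply/idP/eqP => [|->].
  have c_inj := @c_proper _ fS.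
  by case/andP=> /andP[_ wf] /eqP cw; apply: c_inj => //; rewrite cw cv.
rewrite vf cv eqxx !andbT negb_or; apply/andP; split.
  by apply: contra_neq cui => <-.
by apply: contra it => vt; rewrite -cv imset_f.
Qed.
End Coloring.

(** * Spectral bounds *)

Theorem theorem1p5 (R : realType) (V : finType) (X : {set {set V}}) (n : nat)
  (lambda : R) :
  (1 <= n)%N ->
  simplicial_complex X ->
  pure X n ->
  connected_complex X ->
  connected_links X n ->
  partite X n ->
  (n%:R - 1) / n%:R < lambda ->
  (forall s : {set V}, s \in simplices X (n%:Z - 2) ->
     lambda <= spectral_gap R X n s) ->
  forall (k : int) (t : {set V}) (mu : R),
    -1 <= k -> k <= n%:Z - 2 ->
    t \in simplices X k ->
    laplacian_eigenvalue X n t mu ->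
    0 < mu -> mu < (n%:Z - k)%:~R / (n%:Z - k - 1)%:~R ->
    iter (absz (n%:Z - k - 2)%R) (@descent R) lambda <= mu
    /\ mu <= 1 + (n%:Z - k)%:~R
                 * (1 - iter (absz (n%:Z - k - 2)%R) (@descent R) lambda).
Proof.
move=> n_gt0 complexX pureX _ linksX partX lambda_gt gapX k t mu _ k_le.
rewrite inE /sdim => /andP[tX /eqP kE] mu_eig mu_gt0.
have tn : (#|t| < n)%N by lia.
have jE : absz (n%:Z - k - 2)%R = (n - #|t|).-1 by lia.
have kdE : n%:Z - k = (n - #|t|).+1%N%:Z by lia.
have -> : (n%:Z - k - 1)%:~R = (n - #|t|)%:R :> R.
  by rewrite kdE -addn1 PoszD addrK.
rewrite jE kdE -!pmulrn => mu_lt.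
set d := (n - #|t|)%N in mu_lt *; set g := iter _ _ _.
have d_gt0 : (0 < d)%N by rewrite subn_gt0.
have b_sym u v := edge_weight_sym R X n t u v.
have b_ge0 u v := edge_weight_ge0 R X n t u v.
have ge_g : forall nu phi, 0 < nu ->
    eigenfunction (edge_weight R X n t) nu phi -> g <= nu.
  apply: (eigenvalue_ge complexX pureX linksX lambda_gt gapX tX).
  by rewrite /d; lia.
have [phi phi_eig] := (laplacian_eigenvalueP complexX pureX mu tX tn).1 mu_eig.
have g_le_mu := ge_g _ _ mu_gt0 phi_eig; split=> //.
have [c c_proper] := partite_coloring complexX partX.
have mu_le : mu - 1 <= d%:R * (1 - g).
  apply: (@partite_eigenvalue_le R V _ (edge_weight R X n t) c (~: (c @: t)) d
            g mu phi) => //.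
  - by rewrite (card_free_colors c_proper) // subSn // ltnW.
  - exact: edge_weight_same_color.
  - exact: degree_free_color.
  - by move=> u i; exact: degree_color_class.
  - by apply: poincare => //; exact: link_graph_connected.
  - by rewrite gt_eqF.
  by rewrite lt_eqF.
have d_gt0R : 0 < d%:R :> R by rewrite ltr0n.
have g_le1 : g <= 1.
  rewrite leNgt; apply/negP => g_gt1.
  have : d%:R * (1 - g) < 0 by rewrite pmulr_rlt0 // subr_lt0.
  lra.
by rewrite -natr1; lra.
Qed.
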